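(* The following hold. (1) For every $n\in\mathbb{N}$, if $n_0$ is the product of the distinct prime divisors of $n$, then $\tilde{\varphi}(n) \ge \tilde{\varphi}(n_0)$. (2) Let $n,k \in \mathbb{N}$ with $n \ge 3$. Then $\tilde{\varphi}(n^k) < \tilde{\varphi}(n^{k+1})$. (3) Let $n,p,q\in\mathbb{N}$, where $p,q$ are primes with $p<q$ and $\gcd(p,n)=1$. Then $\tilde{\varphi}(np) \le \tilde{\varphi}(nq)$. (4) If $a \in \mathbb{N}$ and $\omega(a) = i$, then $\tilde{\varphi}(N_i) \le \tilde{\varphi}(a)$.
   Context: $\mathbb{N}$ denotes the set of positive integers. For $n \in \mathbb{N}$, let $E_n = \{m \in \mathbb{N} : 1 \le m \le n,\ \gcd(m,n)=1,\ m \text{ is not a prime}\}$ and $\tilde{\varphi}(n) = |E_n|$ (note that $1$ is not a prime). $\omega(n)$ is the number of distinct prime divisors of $n$. $N_j = p_1p_2\cdots p_j$ is the product of the first $j$ primes (for example $N_3=30$), with the empty product $N_0=1$. *)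

(* Defs.v *)
From mathcomp Require Import all_boot.
Set Implicit Arguments.
Unset Strict Implicit.
Unset Printing Implicit Defensive.

Definition coprime_nonprimes (n : nat) : {set 'I_n.+1} :=
  [set m : 'I_n.+1 | [&& 0 < m, coprime m n & ~~ prime m]].

Definition phi_tilde (n : nat) : nat := #|coprime_nonprimes n|.

(* Number of distinct prime divisors: [primes n] has no repetitions. *)
Definition omega (n : nat) : nat := size (primes n).

Definition radical (n : nat) : nat := \prod_(p <- primes n) p.

Lemma ex_next_prime (n : nat) : exists p, (n < p) && prime p.
Proof. by have [p ltnp pr_p] := prime_above n; exists p; rewrite ltnp. Qed.

Definition next_prime (n : nat) : nat := ex_minn (ex_next_prime n).

(* Indexed from 0: the values are 2, 3, 5, 7, and so on. *)
Fixpoint nth_prime (j : nat) : nat :=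
  if j is i.+1 then next_prime (nth_prime i) else 2.

Definition primorial (j : nat) : nat := \prod_(i < j) nth_prime i.

(* Main.v *)
Require Import Defs.
From mathcomp Require Import all_boot.

(** Write [E n] for the set counted by [phi_tilde n].  Every inequality comes
    from exhibiting distinct elements of [E] ([size_le_phi_tilde]).

    Radicals: [radical n <= n], and both have the same prime divisors, hence
    the same coprime integers: [E (radical n)] is contained in [E n].

    Powers: likewise [E (n ^ k)] is contained in [E (n ^ k.+1)], which has the
    further element [n ^ k.+1 - 1 > n ^ k]: it is coprime to [n], and it is
    composite because [n - 1 >= 2] is a proper divisor.

    Exchange of primes: in the factorization of an element of [E (n * p)], turn
    every factor [q] into [p] ([swap_prime]).  The number of prime factors is
    unchanged, so nonprimes stay nonprime; the value does not grow because
    [p < q]; and the map is injective because elements of [E (n * p)] are prime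
    to [p], so that the exponent of [p] in the image recalls that of [q].  The
    image is prime to [q], and to [n] because [p] is: it lies in [E (n * q)].
    All this remains valid when [q] divides [n]; the map is then the identity
    on [E (n * p)].

    Primorials: by the first point, [a] may be replaced by its radical, a
    product of primes [q_1 < ... < q_i].  The [j]-th of them is at least the
    [j]-th prime, so an exchange (if they differ) lowers [q_1] to the first
    prime, then [q_2] to the second, and so on.  In this order the prime put in
    is always coprime to the remaining factors: it exceeds those already lowered
    and is at most [q_j], which is below those still to come
    ([primorial_minimizes]). *)

Set Implicit Arguments.
Unset Strict Implicit.
Unset Printing Implicit Defensive.

(** * Counting with lists *)

Definition coprime_nonprime_seq (n : nat) : seq nat :=
  [seq m <- iota 0 n.+1 | [&& 0 < m, coprime m n & ~~ prime m]].

Lemma mem_coprime_nonprime_seq n m :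
  (m \in coprime_nonprime_seq n) =
  [&& m <= n, 0 < m, coprime m n & ~~ prime m].
Proof. by rewrite mem_filter mem_iota add0n ltnS leq0n /= andbC. Qed.

Lemma uniq_coprime_nonprime_seq n : uniq (coprime_nonprime_seq n).
Proof. by rewrite filter_uniq ?iota_uniq. Qed.

Lemma size_coprime_nonprime_seq n :
  size (coprime_nonprime_seq n) = phi_tilde n.
Proof.
rewrite /phi_tilde /coprime_nonprimes cardsE cardE size_filter.
by rewrite -val_enum_ord count_map enumT -size_filter.
Qed.

Lemma size_le_phi_tilde n (s : seq nat) :
  uniq s -> {subset s <= coprime_nonprime_seq n} -> size s <= phi_tilde n.
Proof.
by move=> s_uniq s_sub; rewrite -size_coprime_nonprime_seq; apply: uniq_leq_size.
Qed.

(** * Radicals *)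

Lemma radical_leq n : 0 < n -> radical n <= n.
Proof.
move=> n_gt0; rewrite {2}(prod_prime_decomp n_gt0) prime_decompE big_map /=.
rewrite /radical big_seq [leqRHS]big_seq; apply: leq_prod => p.
rewrite mem_primes => /and3P[p_pr _ p_dvd_n].
by rewrite -{1}(expn1 p) leq_exp2l ?prime_gt1 // logn_gt0 mem_primes p_pr n_gt0.
Qed.

Lemma coprime_radical m n :
  0 < m -> 0 < n -> coprime m (radical n) -> coprime m n.
Proof.
move=> m_gt0 n_gt0 co_m_rad; rewrite coprime_has_primes //.
apply/hasPn => p pn; apply/negP; rewrite /= mem_primes => /and3P[p_pr _ p_dvd_m].
have p_dvd_rad : p %| radical n by rewrite /radical (big_rem p pn) /= dvdn_mulr.
have := dvdn_gcd p m (radical n).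
by rewrite p_dvd_m p_dvd_rad (eqP co_m_rad) dvdn1 => /eqP p1; rewrite p1 in p_pr.
Qed.

Lemma phi_tilde_radical n : 0 < n -> phi_tilde (radical n) <= phi_tilde n.
Proof.
move=> n_gt0; rewrite -size_coprime_nonprime_seq.
apply: size_le_phi_tilde (uniq_coprime_nonprime_seq _) _ => m.
rewrite !mem_coprime_nonprime_seq => /and4P[m_le m_gt0 m_co ->].
by rewrite m_gt0 (coprime_radical m_gt0 n_gt0 m_co) (leq_trans m_le) ?radical_leq.
Qed.

(** * Powers *)

(** [n - 1] divides [n ^ k.+1 - 1], and lies strictly between [1] and it. *)
Lemma pred_exp_nonprime n k : 3 <= n -> 0 < k -> ~~ prime (n ^ k.+1).-1.
Proof.
move=> n_ge3 k_gt0; apply/negP => pr.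
have n1_neq1 : n.-1 != 1 by case: n n_ge3 {pr} => [|[|[]]].
have n1_dvd : n.-1 %| (n ^ k.+1).-1 by rewrite predn_exp dvdn_mulr.
have n1_eq := prime_nt_dvdP pr n1_neq1 n1_dvd.
have n_gt0 : 0 < n by apply: leq_trans n_ge3.
have : n ^ 1 == n ^ k.+1.
  by rewrite expn1 -[eqbLHS](prednK n_gt0) n1_eq prednK // expn_gt0 n_gt0.
by rewrite eqn_exp2l ?(ltnW n_ge3) // eqSS eq_sym eqn0Ngt k_gt0.
Qed.

Lemma phi_tilde_exp_ltn n k :
  3 <= n -> 0 < k -> phi_tilde (n ^ k) < phi_tilde (n ^ k.+1).
Proof.
move=> n_ge3 k_gt0; have n_gt0 : 0 < n by apply: leq_trans n_ge3.
have nk_gt0 : 0 < n ^ k by rewrite expn_gt0 n_gt0.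
have nk_lt : n ^ k < (n ^ k.+1).-1.
  rewrite -ltnS prednK ?expn_gt0 ?n_gt0 // expnS.
  apply: (@leq_trans (3 * n ^ k)); last by rewrite leq_mul2r n_ge3 orbT.
  by rewrite mulSn -addn2 leq_add2l leq_pmulr.
rewrite -(size_coprime_nonprime_seq (n ^ k)).
apply: (@size_le_phi_tilde _ ((n ^ k.+1).-1 :: _)) => [|m].
  rewrite /= uniq_coprime_nonprime_seq andbT mem_coprime_nonprime_seq.
  by rewrite leqNgt nk_lt.
rewrite inE !mem_coprime_nonprime_seq => /predU1P[->|].
  rewrite leq_pred (leq_ltn_trans (leq0n _) nk_lt) /= pred_exp_nonprime // andbT.
  by rewrite coprimePn // expn_gt0 n_gt0.
case/and4P=> m_le -> m_co ->; rewrite andbT /= coprimeXr; last first.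
  by move: m_co; rewrite coprime_pexpr.
by rewrite andbT (leq_trans m_le) // leq_exp2l // ltnW.
Qed.

(** * Exchanging two primes *)

(** [m] with every prime factor [q] turned into [p]. *)
Definition swap_prime (p q m : nat) : nat := m`_q^' * p ^ logn q m.

Lemma swap_prime_id p m : 0 < m -> swap_prime p p m = m.
Proof. by move=> m_gt0; rewrite /swap_prime -p_part mulnC partnC. Qed.

Lemma coprime_part p m n : coprime m n -> coprime m`_p^' n.
Proof. exact: coprime_dvdl (dvdn_part _ _). Qed.

Lemma swap_prime_leq p q m : 0 < m -> p <= q -> swap_prime p q m <= m.
Proof.
move=> m_gt0 p_le_q; rewrite -[leqRHS](swap_prime_id q) //.
rewrite /swap_prime leq_mul2l; apply/orP; right.
by case: (logn q m) => // e; rewrite leq_exp2r.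
Qed.

(** For [m] prime to [p], every factor [p] of the image comes from a factor
    [q] of [m], so the exponent of [q] in [m] can be read off the image. *)
Lemma swap_prime_inj p q :
  prime p -> {in [pred m | (0 < m) && coprime m p] &, injective (swap_prime p q)}.
Proof.
move=> p_pr; pose P m := (0 < m) && coprime m p.
have logE m : P m -> logn p (swap_prime p q m) = logn q m.
  case/andP=> m_gt0 co_mp; rewrite lognM ?part_gt0 ?expn_gt0 ?prime_gt0 //.
  by rewrite pfactorK // logn_coprime // coprime_sym coprime_part.
move=> m1 m2 Pm1 Pm2 eq12.
have eqlog : logn q m1 = logn q m2 by rewrite -!logE // eq12.
have [[m1_gt0 _] [m2_gt0 _]] := (andP Pm1, andP Pm2).
rewrite -(swap_prime_id q m1_gt0) -(swap_prime_id q m2_gt0).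
congr (_ * _); last by rewrite eqlog.
move/eqP: eq12; rewrite /swap_prime eqlog eqn_pmul2r ?expn_gt0 ?prime_gt0 //.
by move/eqP.
Qed.

(** The image has as many prime factors as [m], counted with multiplicity;
    the proof avoids that count by looking at the exponent of [q]. *)
Lemma swap_prime_nonprime p q m :
  prime p -> prime q -> 0 < m -> ~~ prime m -> ~~ prime (swap_prime p q m).
Proof.
move=> p_pr q_pr m_gt0; apply: contra.
rewrite -[in prime m](swap_prime_id q m_gt0) /swap_prime.
case: (logn q m) => [|e] // pr.
(* A prime divisible by [p] is [p], so the cofactor is trivial. *)
have : p == m`_q^' * p ^ e.+1.
  by rewrite -dvdn_prime2 // expnS mulnCA dvdn_mulr.
rewrite expnS mulnCA -{1}(muln1 p) eqn_pmul2l ?prime_gt0 // eq_sym muln_eq1.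
case/andP=> /eqP -> /eqP pe1; rewrite mul1n.
suff -> : e = 0 by rewrite expn1.
by case: e pe1 {pr} => // e /eqP; rewrite expnS muln_eq1 (gtn_eqF (prime_gt1 p_pr)).
Qed.

Lemma coprime_swap_prime p q m n :
  coprime p n -> coprime m n -> coprime (swap_prime p q m) n.
Proof. by move=> pn mn; rewrite coprimeMl coprime_part // coprimeXl. Qed.

Lemma coprime_swap_prime_r p q m :
  coprime p q -> prime q -> 0 < m -> coprime (swap_prime p q m) q.
Proof.
move=> pq q_pr m_gt0; rewrite coprimeMl coprimeXl // andbT coprime_sym.
by rewrite prime_coprime // -p'natE // part_pnat.
Qed.

Lemma coprime_ltn_prime p q : prime p -> prime q -> p < q -> coprime p q.
Proof.
by move=> p_pr q_pr p_lt; rewrite prime_coprime // dvdn_prime2 // ltn_eqF.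
Qed.

Lemma phi_tilde_mul_prime_leq n p q :
  0 < n -> prime p -> prime q -> p < q -> coprime p n ->
  phi_tilde (n * p) <= phi_tilde (n * q).
Proof.
move=> n_gt0 p_pr q_pr p_lt_q co_pn; rewrite -size_coprime_nonprime_seq.
rewrite -(size_map (swap_prime p q)); apply: size_le_phi_tilde.
  rewrite map_inj_in_uniq ?uniq_coprime_nonprime_seq // => m1 m2.
  rewrite !mem_coprime_nonprime_seq !coprimeMr.
  case/and4P=> _ m1_gt0 /andP[_ m1_co] _ /and4P[_ m2_gt0 /andP[_ m2_co] _].
  by apply: swap_prime_inj => //; rewrite inE /= ?m1_gt0 ?m2_gt0.
have co_pq : coprime p q := coprime_ltn_prime p_pr q_pr p_lt_q.
move=> _ /mapP[m + ->]; rewrite !mem_coprime_nonprime_seq coprimeMr.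
case/and4P=> m_le m_gt0 /andP[m_co_n _] m_npr.
rewrite swap_prime_nonprime // coprimeMr coprime_swap_prime //.
rewrite coprime_swap_prime_r // muln_gt0 part_gt0 expn_gt0 prime_gt0 //= !andbT.
apply: leq_trans (swap_prime_leq m_gt0 (ltnW p_lt_q)) (leq_trans m_le _).
by rewrite leq_mul2l (ltnW p_lt_q) orbT.
Qed.

(** * Primorials *)

Lemma next_prime_prime n : prime (next_prime n).
Proof. by rewrite /next_prime; case: ex_minnP => p /andP[]. Qed.

Lemma next_prime_gt n : n < next_prime n.
Proof. by rewrite /next_prime; case: ex_minnP => p /andP[]. Qed.

Lemma next_prime_leq n p : n < p -> prime p -> next_prime n <= p.
Proof.
move=> n_lt p_pr; rewrite /next_prime; case: ex_minnP => m _; apply.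
by rewrite n_lt.
Qed.

Lemma nth_prime_prime j : prime (nth_prime j).
Proof. by case: j => // j; apply: next_prime_prime. Qed.

Lemma nth_prime_ltn : {homo nth_prime : i j / i < j}.
Proof. exact: homo_ltn ltn_trans (fun i => next_prime_gt (nth_prime i)). Qed.

Lemma primorial_gt0 j : 0 < primorial j.
Proof. by apply: prodn_gt0 => i; apply: prime_gt0 (nth_prime_prime i). Qed.

Lemma coprime_nth_prime_primorial j : coprime (nth_prime j) (primorial j).
Proof.
rewrite /primorial; elim/big_ind: _ => [|x y xj yj|i _].
- exact: coprimen1.
- by rewrite coprimeMr xj.
by rewrite coprime_sym coprime_ltn_prime ?nth_prime_prime ?nth_prime_ltn.
Qed.

(** Lowering the primes of [s] one after the other, from the smallest on; the
    induction keeps the [j] primes already lowered as a factor. *)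
Lemma primorial_minimizes j (s : seq nat) :
  sorted ltn s -> all prime s -> all (leq (nth_prime j)) s ->
  phi_tilde (primorial (j + size s)) <=
  phi_tilde (primorial j * \prod_(q <- s) q).
Proof.
elim: s j => [|q s IHs] j; first by rewrite big_nil muln1 addn0.
rewrite /= (path_sortedE ltn_trans) => /andP[q_lt s_sorted] /andP[q_pr s_pr].
case/andP=> pj_le _; set p := nth_prime j in pj_le *.
have p_pr : prime p := nth_prime_prime j.
have p_lt r : r \in s -> p < r by move/(allP q_lt); apply: leq_ltn_trans.
have le1 : phi_tilde (primorial (j + (size s).+1)) <=
           phi_tilde (primorial j.+1 * \prod_(r <- s) r).
  rewrite addnS -addSn; apply: IHs => //.
  apply/allP => r rs; apply: next_prime_leq (p_lt r rs) _; exact: (allP s_pr).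
apply: leq_trans le1 _.
rewrite big_cons [primorial j.+1]big_ord_recr /= -/(primorial j) -/p.
rewrite mulnAC mulnCA [q * _]mulnC.
have [-> //|p_neq_q] := eqVneq p q.
apply: phi_tilde_mul_prime_leq => //.
- rewrite muln_gt0 primorial_gt0 big_seq.
  by apply: prodn_cond_gt0 => r rs; apply/prime_gt0/(allP s_pr).
- by rewrite ltn_neqAle p_neq_q.
rewrite coprimeMr coprime_nth_prime_primorial big_seq /=.
elim/big_ind: _ => [|x y xp yp|r rs].
- exact: coprimen1.
- by rewrite coprimeMr xp.
exact: coprime_ltn_prime p_pr (allP s_pr r rs) (p_lt r rs).
Qed.

Lemma phi_tilde_primorial_leq a :
  0 < a -> phi_tilde (primorial (omega a)) <= phi_tilde a.
Proof.
move=> a_gt0; apply: leq_trans (phi_tilde_radical a_gt0).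
have primes_pr : all prime (primes a).
  by apply/allP => p; rewrite mem_primes => /andP[].
have -> : radical a = primorial 0 * \prod_(q <- primes a) q.
  by rewrite /primorial big_ord0 mul1n.
apply: (primorial_minimizes (j := 0) (sorted_primes a) primes_pr).
by apply/allP => p /(allP primes_pr)/prime_gt1.
Qed.

Theorem proposition1 :
  (forall n : nat, 0 < n -> phi_tilde (radical n) <= phi_tilde n) /\
  (forall n k : nat, 3 <= n -> 0 < k ->
     phi_tilde (n ^ k) < phi_tilde (n ^ k.+1)) /\
  (forall n p q : nat, 0 < n -> prime p -> prime q -> p < q ->
     coprime p n -> phi_tilde (n * p) <= phi_tilde (n * q)) /\
  (forall a i : nat, 0 < a -> omega a = i ->
     phi_tilde (primorial i) <= phi_tilde a).
Proof.
split; first exact: phi_tilde_radical.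
split; first exact: phi_tilde_exp_ltn.
split; first exact: phi_tilde_mul_prime_leq.
by move=> a i a_gt0 <-; apply: phi_tilde_primorial_leq.
Qed.
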